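(* Let $A\subseteq\mathbf{R}$ and let $f:A\times A\to\mathbf{R}$ be a factorable double function. Suppose that $f$ preserves factorable slowly oscillating double sequences from $A\times A$, i.e. for every factorable slowly oscillating double sequence $\{x_{k,l}\}$ of points of $A\times A$ the double sequence $\{f(x_{k,l})\}$ is slowly oscillating. Then $f$ preserves factorable $P$-convergent double sequences from $A\times A$, i.e. for every factorable $P$-convergent double sequence $\{x_{k,l}\}$ of points of $A\times A$ the double sequence $\{f(x_{k,l})\}$ is $P$-convergent.
   Context: A double sequence is a family $\{x_{k,l}\}$ indexed by pairs of positive integers $k,l$. Write $|\cdot|$ for the absolute value on $\mathbf{R}$ and for the Euclidean norm on $\mathbf{R}^2$. A double sequence $\{x_{k,l}\}$ of points of $\mathbf{R}$ (or of $\mathbf{R}^2$) is slowly oscillating if for every $\varepsilon>0$ there exist $\alpha=\alpha(\varepsilon)>0$, $\delta=\delta(\varepsilon)>0$ and a positive integer $N=N(\varepsilon)$ such that $|x_{k,l}-x_{s,t}|<\varepsilon$ for all positive integers $k,l,s,t$ with $k,l\ge N$, $k\le s\le(1+\alpha)k$ and $l\le t\le(1+\delta)l$. A double sequence $\{x_{k,l}\}$ of points of $\mathbf{R}$ (resp. $\mathbf{R}^2$) is $P$-convergent (convergent in Pringsheim's sense) if there is a point $L$ of $\mathbf{R}$ (resp. $\mathbf{R}^2$) such that for every $\epsilon>0$ there is $N\in\mathbf{N}$ with $|x_{k,l}-L|<\epsilon$ whenever $k,l>N$. A function $f:A\times A\to\mathbf{R}$ is a factorable double function if there are functions $g,h:A\to\mathbf{R}$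 with $f(x,y)=g(x)h(y)$ for all $x,y\in A$. A double sequence $\{x_{k,l}\}$ of points of $A\times A$ is factorable if there are single sequences $(a_k)$, $(b_l)$ in $A$ with $x_{k,l}=(a_k,b_l)$ for all $k,l$. *)

(* Defs.v *)
From Stdlib Require Import Reals.
From Coquelicot Require Import Coquelicot.
Open Scope R_scope.

(* Double sequences are functions [nat -> nat -> V] of which only the values at
   positive indices are ever considered; a function on [A * A] is a total
   function on [R * R] of which only the values at points of [A * A] are ever
   considered.

   [V] is instantiated with [R], where Coquelicot's [norm] is [Rabs], and with
   [R * R], where it is [prod_norm]: (u, v) |-> sqrt (|u|^2 + |v|^2), i.e. the
   Euclidean norm. *)

Definition slowly_oscillating {V : NormedModule R_AbsRing}
    (x : nat -> nat -> V) : Prop :=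
  forall eps : R, 0 < eps ->
  exists (alpha delta : R) (N : nat),
    0 < alpha /\ 0 < delta /\ (1 <= N)%nat /\
    forall k l s t : nat,
      (N <= k)%nat -> (N <= l)%nat ->
      (k <= s)%nat -> INR s <= (1 + alpha) * INR k ->
      (l <= t)%nat -> INR t <= (1 + delta) * INR l ->
      norm (minus (x k l) (x s t)) < eps.

Definition P_convergent {V : NormedModule R_AbsRing}
    (x : nat -> nat -> V) : Prop :=
  exists L : V, forall eps : R, 0 < eps ->
  exists N : nat, forall k l : nat,
    (N < k)%nat -> (N < l)%nat -> norm (minus (x k l) L) < eps.

Definition factorable_function (A : R -> Prop) (f : R * R -> R) : Prop :=
  exists g h : R -> R, forall x y : R, A x -> A y -> f (x, y) = g x * h y.

(* In particular all terms of the double sequence lie in [A * A]. *)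
Definition factorable_sequence (A : R -> Prop) (x : nat -> nat -> R * R) : Prop :=
  exists a b : nat -> R,
    (forall k : nat, (1 <= k)%nat -> A (a k)) /\
    (forall l : nat, (1 <= l)%nat -> A (b l)) /\
    forall k l : nat, (1 <= k)%nat -> (1 <= l)%nat -> x k l = (a k, b l).

Definition preserves_factorable_slowly_oscillating
    (A : R -> Prop) (f : R * R -> R) : Prop :=
  forall x : nat -> nat -> R * R,
    factorable_sequence A x -> slowly_oscillating x ->
    slowly_oscillating (fun k l => f (x k l)).

Definition preserves_factorable_P_convergent
    (A : R -> Prop) (f : R * R -> R) : Prop :=
  forall x : nat -> nat -> R * R,
    factorable_sequence A x -> P_convergent x ->
    P_convergent (fun k l => f (x k l)).

(* Main.v *)
(** For a point [c] of [A] and a convergent sequence [u] in [A], the double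
    sequence [(u k, c)] is P-convergent, hence slowly oscillating, so the
    consecutive differences of [f (u k, c)] tend to zero.  If [f (u k, c)] were not
    Cauchy, interlacing two subsequences whose images stay apart would produce a
    convergent sequence violating this; hence [f (u k, c)] converges, and
    symmetrically for [f (c, v l)].  Writing [f (x, y) = g x * h y], either the
    double sequence [g (a k) * h (b l)] vanishes identically, or some [h (b l)] and
    some [g (a k)] are nonzero; using these as the fixed coordinate shows that
    [g (a k)] and [h (b l)] converge separately. *)

Require Import Defs.
From Stdlib Require Import Reals Lra Lia Classical IndefiniteDescription.
From Coquelicot Require Import Coquelicot.
Open Scope R_scope.

(** The quadrants [N < k], [N < l] form a base of the product filter, and norm balls and uniform
    balls give the same neighbourhoods. Limits of pairs, products and diagonals then follow by
    composing filter limits. *)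
Lemma P_convergent_filterlim {V : NormedModule R_AbsRing} (x : nat -> nat -> V) :
  P_convergent x <->
  exists L : V,
    filterlim (fun kl => x (fst kl) (snd kl))
      (filter_prod eventually eventually) (locally L).
Proof.
  split; intros [L HL]; exists L.
  - intros P HP.
    destruct (locally_norm_le_locally L P HP) as [eps Heps].
    destruct (HL eps (cond_pos eps)) as [N HN].
    exists (fun k => (N < k)%nat) (fun l => (N < l)%nat).
    + exists (S N); intros; lia.
    + exists (S N); intros; lia.
    + intros k l Hk Hl; exact (Heps _ (HN k l Hk Hl)).
  - intros eps Heps.
    assert (Hball : locally L (ball_norm L (mkposreal eps Heps))).
    { apply locally_le_locally_norm; exists (mkposreal eps Heps); tauto. }
    destruct (HL _ Hball) as [P Q [N1 H1] [N2 H2] HPQ].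
    exists (max N1 N2); intros k l Hk Hl.
    apply (HPQ k l); [apply H1 | apply H2]; lia.
Qed.

Lemma P_convergent_pair (u v : nat -> R) (L M : R) :
  is_lim_seq u L -> is_lim_seq v M -> P_convergent (fun k l => (u k, v l)).
Proof.
  intros Hu Hv.
  apply P_convergent_filterlim; exists (L, M).
  (* A uniform ball of [R * R] is a product of balls, so no Euclidean estimate arises. *)
  apply (filterlim_filter_le_2 (G := filter_prod (locally L) (locally M))).
  - intros P [eps Heps].
    exists (ball L eps) (ball M eps); try apply locally_ball.
    intros y z Hy Hz; apply Heps; split; assumption.
  - apply filterlim_pair.
    + exact (filterlim_comp _ _ _ _ _ _ _ _ filterlim_fst Hu).
    + exact (filterlim_comp _ _ _ _ _ _ _ _ filterlim_snd Hv).
Qed.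

Lemma P_convergent_mult (u v : nat -> R) (L M : R) :
  is_lim_seq u L -> is_lim_seq v M -> P_convergent (fun k l => u k * v l).
Proof.
  intros Hu Hv.
  apply P_convergent_filterlim; exists (L * M).
  apply (filterlim_comp_2 (G := locally L) (H := locally M)).
  - exact (filterlim_comp _ _ _ _ _ _ _ _ filterlim_fst Hu).
  - exact (filterlim_comp _ _ _ _ _ _ _ _ filterlim_snd Hv).
  - exact (filterlim_mult L M).
Qed.

(** For a factorable sequence the diagonal [(a n, b n)] already determines the limits of both
    factors. *)
Lemma P_convergent_diagonal {V : NormedModule R_AbsRing} (x : nat -> nat -> V) :
  P_convergent x ->
  exists L : V, filterlim (fun n => x n n) eventually (locally L).
Proof.
  intros Hx; apply P_convergent_filterlim in Hx as [L HL]; exists L.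
  apply (filterlim_comp _ _ _ (fun n : nat => (n, n)) _ _ _ _
           (filterlim_pair _ _ (filterlim_id _ _) (filterlim_id _ _)) HL).
Qed.

Lemma P_convergent_ext_pos {V : NormedModule R_AbsRing} (x y : nat -> nat -> V) :
  (forall k l : nat, (1 <= k)%nat -> (1 <= l)%nat -> x k l = y k l) ->
  P_convergent x -> P_convergent y.
Proof.
  intros Hxy [L HL]; exists L; intros eps Heps.
  destruct (HL eps Heps) as [N HN].
  exists N; intros k l Hk Hl.
  rewrite <- Hxy by lia; apply HN; assumption.
Qed.

Lemma P_convergent_slowly_oscillating {V : NormedModule R_AbsRing}
    (x : nat -> nat -> V) :
  P_convergent x -> slowly_oscillating x.
Proof.
  intros [L HL] eps Heps.
  destruct (HL (eps / 2)) as [N HN]; [lra|].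
  (* As [k <= s] and [l <= t], both terms lie in the tail, within [eps / 2] of [L]; the tail is
     strict, hence [S N]. *)
  exists 1, 1, (S N); repeat split; try lra; try lia.
  intros k l s t Hk Hl Hs _ Ht _.
  rewrite (minus_trans L).
  eapply Rle_lt_trans; [apply norm_triangle|].
  rewrite <- (norm_opp (minus L (x s t))), opp_minus.
  generalize (HN k l ltac:(lia) ltac:(lia)) (HN s t ltac:(lia) ltac:(lia)); lra.
Qed.

(** Once [alpha * n >= 1] and [delta * n >= 1], the index [n + 1] lies in both windows starting at
    [n]. *)
Lemma slowly_oscillating_diagonal_step {V : NormedModule R_AbsRing}
    (x : nat -> nat -> V) :
  slowly_oscillating x ->
  forall eps : R, 0 < eps ->
  exists N : nat, forall n : nat, (N <= n)%nat ->
    norm (minus (x n n) (x (S n) (S n))) < eps.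
Proof.
  intros Hx eps Heps.
  destruct (Hx eps Heps) as (alpha & delta & N & Ha & Hd & _ & HN).
  destruct (nfloor_ex (/ alpha)) as [p [_ Hp]].
  { left; apply Rinv_0_lt_compat, Ha. }
  destruct (nfloor_ex (/ delta)) as [q [_ Hq]].
  { left; apply Rinv_0_lt_compat, Hd. }
  assert (Hstep : forall (c : R) (m n : nat),
    0 < c -> / c < INR m + 1 -> (m < n)%nat -> INR (S n) <= (1 + c) * INR n).
  { intros c m n Hc Hm Hmn.
    apply le_INR in Hmn; rewrite S_INR in Hmn |- *.
    assert (c * / c <= c * INR n) by (apply Rmult_le_compat_l; lra).
    rewrite Rinv_r in H by lra; lra. }
  exists (S (max N (max p q))); intros n Hn.
  apply HN; try lia.
  - apply (Hstep alpha p); try assumption; lia.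
  - apply (Hstep delta q); try assumption; lia.
Qed.

Lemma preserves_factorable_step (A : R -> Prop) (f : R * R -> R)
    (u v : nat -> R) (L M : R) :
  preserves_factorable_slowly_oscillating A f ->
  (forall n, A (u n)) -> (forall n, A (v n)) ->
  is_lim_seq u L -> is_lim_seq v M ->
  is_lim_seq (fun n => f (u n, v n) - f (u (S n), v (S n))) 0.
Proof.
  intros hso HAu HAv Hu Hv.
  apply is_lim_seq_spec; intros eps.
  destruct (slowly_oscillating_diagonal_step (fun k l => f (u k, v l)))
    with (eps := pos eps) as [N HN].
  - apply (hso (fun k l => (u k, v l))).
    + exists u, v; repeat split; auto.
    + apply P_convergent_slowly_oscillating, (P_convergent_pair u v L M Hu Hv).
  - apply cond_pos.
  - exists N; intros n Hn.
    rewrite Rminus_0_r; exact (HN n Hn).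
Qed.

Lemma interlaced_limit (p q : nat -> R) (L : R) :
  is_lim_seq p L -> is_lim_seq q L ->
  is_lim_seq (fun n => if Nat.even n then p (Nat.div2 n) else q (Nat.div2 n)) L.
Proof.
  intros Hp Hq.
  apply is_lim_seq_spec in Hp, Hq; apply is_lim_seq_spec.
  intros eps.
  destruct (Hp eps) as [N1 H1]; destruct (Hq eps) as [N2 H2].
  exists (2 * max N1 N2)%nat; intros n Hn.
  assert (max N1 N2 <= Nat.div2 n)%nat.
  { rewrite Nat.div2_div; apply Nat.div_le_lower_bound; lia. }
  destruct (Nat.even n); [apply H1 | apply H2]; lia.
Qed.

Lemma converges_of_vanishing_steps (A : R -> Prop) (phi : R -> R) (L : R) :
  (forall u : nat -> R, (forall n, A (u n)) -> is_lim_seq u L ->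
     is_lim_seq (fun n => phi (u n) - phi (u (S n))) 0) ->
  forall u : nat -> R, (forall n, A (u n)) -> is_lim_seq u L ->
    ex_finite_lim_seq (fun n => phi (u n)).
Proof.
  intros Hphi u HA Hu.
  apply ex_lim_seq_cauchy_corr.
  intros eps; apply NNPP; intros Hnot.
  (* Failure of the Cauchy condition at [eps]: beyond every [N] there are two indices with images at
     least [eps] apart. *)
  assert (Hfar : forall N : nat, exists pq : nat * nat,
    (N <= fst pq)%nat /\ (N <= snd pq)%nat /\
    eps <= Rabs (phi (u (fst pq)) - phi (u (snd pq)))).
  { intros N; apply NNPP; intros Hclose; apply Hnot.
    exists N; intros n m Hn Hm.
    apply Rnot_le_lt; intros Hle; apply Hclose.
    exists (n, m); auto. }
  apply functional_choice in Hfar as [pq Hpq].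
  (* The chosen indices need not increase; [n <= r n] is enough to keep the limit. *)
  assert (Hsub : forall r : nat -> nat, (forall n, (n <= r n)%nat) ->
    is_lim_seq (fun n => u (r n)) L).
  { intros r Hr.
    apply (filterlim_comp _ _ _ r u _ eventually); [|exact Hu].
    intros P [N HN]; exists N; intros n Hn.
    apply HN; specialize (Hr n); lia. }
  pose (w := fun n => if Nat.even n then u (fst (pq (Nat.div2 n)))
                      else u (snd (pq (Nat.div2 n)))).
  assert (Hw : is_lim_seq (fun n => phi (w n) - phi (w (S n))) 0).
  { apply Hphi.
    - intros n; unfold w; destruct (Nat.even n); apply HA.
    - apply (interlaced_limit (fun n => u (fst (pq n))) (fun n => u (snd (pq n))));
        apply (Hsub (fun n => _ (pq n))); intros n; apply Hpq. }
  apply is_lim_seq_spec in Hw.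
  destruct (Hw eps) as [N HN].
  (* The step of [w] from [2 * N] to [2 * N + 1] joins the two members of the pair [pq N], whose
     images are far apart. *)
  specialize (HN (2 * N)%nat ltac:(lia)).
  rewrite Rminus_0_r in HN; unfold w in HN.
  rewrite Nat.even_succ, Nat.div2_succ_double, Nat.div2_double, <- Nat.negb_even,
    Nat.even_mul in HN; simpl in HN.
  destruct (Hpq N) as (_ & _ & Hge); lra.
Qed.

Lemma ex_finite_lim_seq_of_scaled_tail (c : R) (u v : nat -> R) :
  c <> 0 -> (forall n, v n = c * u (S n)) ->
  ex_finite_lim_seq v -> ex_finite_lim_seq u.
Proof.
  intros Hc Hv [l Hl]; exists (/ c * l).
  apply is_lim_seq_incr_1, (is_lim_seq_ext (fun n => / c * v n)).
  - intros n; rewrite Hv; field; exact Hc.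
  - exact (is_lim_seq_scal_l _ (/ c) l Hl).
Qed.

Theorem theorem3p2 (A : R -> Prop) (f : R * R -> R)
  (hfact : factorable_function A f)
  (hso : preserves_factorable_slowly_oscillating A f) :
  preserves_factorable_P_convergent A f.
Proof.
  intros x (a & b & HA & HB & Hab) Hx.
  destruct hfact as (g & h & Hf).
  assert (Hfx : forall k l, (1 <= k)%nat -> (1 <= l)%nat ->
    g (a k) * h (b l) = f (x k l)).
  { intros k l Hk Hl; rewrite Hab, Hf; auto. }
  apply (P_convergent_ext_pos (fun k l => g (a k) * h (b l))); [exact Hfx|].
  assert (Hzero : (forall k l, (1 <= k)%nat -> (1 <= l)%nat -> 0 = g (a k) * h (b l)) ->
    P_convergent (fun k l => g (a k) * h (b l))).
  { intros H0; apply (P_convergent_ext_pos (fun _ _ => 0) _ H0).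
    exists 0; intros eps Heps; exists 0%nat; intros k l _ _.
    change (Rabs (0 - 0) < eps); rewrite Rminus_0_r, Rabs_R0; exact Heps. }
  destruct (classic (exists l, (1 <= l)%nat /\ h (b l) <> 0)) as [(m & Hm & Hhm)|Hh0].
  2: { apply Hzero; intros k l Hk Hl.
       destruct (Req_dec (h (b l)) 0) as [->|Hne]; [ring|].
       exfalso; eauto. }
  destruct (classic (exists k, (1 <= k)%nat /\ g (a k) <> 0)) as [(n & Hn & Hgn)|Hg0].
  2: { apply Hzero; intros k l Hk Hl.
       destruct (Req_dec (g (a k)) 0) as [->|Hne]; [ring|].
       exfalso; eauto. }
  (* Projecting the limit of the diagonal gives the limits of [a] and [b], which need not belong to
     [A]. *)
  apply (P_convergent_ext_pos x (fun k l => (a k, b l)) Hab),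
    P_convergent_diagonal in Hx as [[L M] HLM].
  assert (Ha : is_lim_seq a L).
  { exact (filterlim_comp _ _ _ _ fst _ _ _ HLM (continuous_fst L M)). }
  assert (Hb : is_lim_seq b M).
  { exact (filterlim_comp _ _ _ _ snd _ _ _ HLM (continuous_snd L M)). }
  assert (Hg : ex_finite_lim_seq (fun k => g (a k))).
  { apply (ex_finite_lim_seq_of_scaled_tail (h (b m)) _
             (fun k => f (a (S k), b m)) Hhm).
    { intros k; rewrite Hf by (auto; apply HA; lia); ring. }
    apply (converges_of_vanishing_steps A (fun y => f (y, b m)) L).
    - intros u HAu Hu.
      apply (preserves_factorable_step A f u (fun _ => b m) L (b m)); auto.
      apply is_lim_seq_const.
    - intros k; apply HA; lia.
    - exact (proj1 (is_lim_seq_incr_1 a L) Ha). }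
  assert (Hh : ex_finite_lim_seq (fun l => h (b l))).
  { apply (ex_finite_lim_seq_of_scaled_tail (g (a n)) _
             (fun l => f (a n, b (S l))) Hgn).
    { intros l; apply Hf; apply HA || apply HB; lia. }
    apply (converges_of_vanishing_steps A (fun y => f (a n, y)) M).
    - intros v HAv Hv.
      apply (preserves_factorable_step A f (fun _ => a n) v (a n) M); auto.
      apply is_lim_seq_const.
    - intros l; apply HB; lia.
    - exact (proj1 (is_lim_seq_incr_1 b M) Hb). }
  destruct Hg as [G HG]; destruct Hh as [H HH].
  exact (P_convergent_mult _ _ G H HG HH).
Qed.
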